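(* Let $X\in\mathbb{R}^{n\times p}$ be a matrix all of whose columns have unit Euclidean norm, and let $\epsilon\in(0,1)$. Let $R$ be a positive integer satisfying $$R\log R\;\le\;\frac{\epsilon^2}{4(1+\epsilon)}\,\frac{p}{\|X\|^2}.$$ Then there exists a subset $T\subset\{1,\dots,p\}$ with $|T|\ge R$ such that $$1-\epsilon\;\le\;\lambda_{\min}(X_T^tX_T)\;\le\;\lambda_{\max}(X_T^tX_T)\;\le\;1+\epsilon.$$
   Context: $\|X\|$ denotes the operator norm of $X$ (from $\ell_2$ to $\ell_2$), and $\log$ is the natural logarithm. For $T\subset\{1,\dots,p\}$, $X_T$ is the $n\times|T|$ submatrix of $X$ formed by the columns indexed by $T$. For a real symmetric matrix $A$, $\lambda_{\min}(A)$ and $\lambda_{\max}(A)$ denote its smallest and largest eigenvalues. *)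

(* Defs.v *)
From Stdlib Require Import Reals Lra List ClassicalEpsilon.
Open Scope R_scope.

Fixpoint rsum (n : nat) (f : nat -> R) : R :=
  match n with
  | O => 0
  | S k => rsum k f + f k
  end.

(* A real n x p matrix is represented by its entry function X i j,
   only the entries with i < n, j < p being relevant. *)

Definition vnorm (m : nat) (v : nat -> R) : R := sqrt (rsum m (fun i => v i ^ 2)).

Definition mxv (n p : nat) (X : nat -> nat -> R) (v : nat -> R) : nat -> R :=
  fun i => rsum p (fun j => X i j * v j).

Definition is_glb (E : R -> Prop) (m : R) : Prop :=
  (forall x, E x -> m <= x) /\ (forall b, (forall x, E x -> b <= x) -> b <= m).

Definition opnorm (n p : nat) (X : nat -> nat -> R) : R :=
  epsilon (inhabits 0)
    (is_lub (fun y => exists v : nat -> R, vnorm p v <= 1 /\ y = vnorm n (mxv n p X v))).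

(* X_T^t X_T for T given as a list of distinct column indices: a |T| x |T| matrix *)
Definition gramT (n : nat) (X : nat -> nat -> R) (T : list nat) : nat -> nat -> R :=
  fun a b => rsum n (fun i => X i (nth a T 0%nat) * X i (nth b T 0%nat)).

Definition is_eigenvalue (m : nat) (A : nat -> nat -> R) (lam : R) : Prop :=
  exists v : nat -> R,
    (exists k, (k < m)%nat /\ v k <> 0) /\
    forall a, (a < m)%nat -> rsum m (fun b => A a b * v b) = lam * v a.

Definition lambda_min (m : nat) (A : nat -> nat -> R) : R :=
  epsilon (inhabits 0) (is_glb (is_eigenvalue m A)).

Definition lambda_max (m : nat) (A : nat -> nat -> R) : R :=
  epsilon (inhabits 0) (is_lub (is_eigenvalue m A)).

(* Main.v *)
(* Barrier argument, in the style of Batson, Spielman and Srivastava. Let [G] be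
   the Gram matrix of the columns chosen so far and [H = G - 1]. For a barrier
   [u] with [-u < H < u] consider the potential
   [tr (u - H)^-1 + tr (u + H)^-1]. Appending a column [x] borders [u - H] and
   [u + H] with the vector [-w], resp. [w], where [w = Y^T x], and the Schur
   complement expresses the new potential through quadratic forms in [w].
   Averaged over all columns of [X], a form [w^T M w] is at most
   [m tr M] with [m = (1 + eps) |X|^2 / p]; hence some column allows the barrier
   to move by [d] while [m] times the potential grows by at most [2 d].
   With [R = k + 1], moving the barrier up to [eps] in [k] steps of size
   [d = eps / (4 k)] leaves room for a last column as soon as
   [m <= eps^2 (k + 1) / (8 k^2)], which follows from the hypothesis and
   [ln R >= 2 (R - 1) / (R + 1)]. *)
Require Import Defs.
From Stdlib Require Import Reals Lra List ClassicalEpsilon.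
Open Scope R_scope.

(** The function [ln x + 4 / (x + 1)] equals 2 at 1 and has derivative
    [(x - 1)^2 / (x (x + 1)^2) >= 0], so the mean value theorem applies. *)
Lemma ln_ge_rational (x : R) : 1 <= x -> 2 * (x - 1) / (x + 1) <= ln x.
Proof.
intros [x1|<-]; [|rewrite ln_1; apply Req_le; field].
destruct (MVT_cor2 (ln + (fct_cte 4 / (id + fct_cte 1)))%F
  (fun y => / y + (0 * (y + 1) - (1 + 0) * 4) / (y + 1)²) 1 x) as [c [fE [c1 _]]]; auto.
{ intros c [c1 _]; apply derivable_pt_lim_plus.
  { apply derivable_pt_lim_ln; lra. }
  apply (derivable_pt_lim_div (fct_cte 4) (id + fct_cte 1)%F).
  { apply derivable_pt_lim_const. }
  { apply derivable_pt_lim_plus; [apply derivable_pt_lim_id | apply derivable_pt_lim_const]. }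
  unfold plus_fct, id, fct_cte; lra. }
assert (f'_ge0 : 0 <= / c + (0 * (c + 1) - (1 + 0) * 4) / (c + 1)²).
{ replace (/ c + (0 * (c + 1) - (1 + 0) * 4) / (c + 1)²)
    with ((c - 1)² * / (c * (c + 1)²)) by (unfold Rsqr; field; lra).
  apply Rmult_le_pos; [apply Rle_0_sqr|].
  apply Rlt_le, Rinv_0_lt_compat, Rmult_lt_0_compat; [lra|apply Rlt_0_sqr; lra]. }
replace (2 * (x - 1) / (x + 1)) with (2 - 4 / (x + 1)) by (field; lra).
assert (d0 : 0 <= x - 1) by lra.
pose proof (Rmult_le_pos _ _ f'_ge0 d0) as h; rewrite <- fE in h.
unfold plus_fct, div_fct, plus_fct, id, fct_cte in h; rewrite ln_1 in h; lra.
Qed.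

From mathcomp Require Import all_boot all_order all_algebra.
From mathcomp Require Import complex ring lra Rstruct.
Set Implicit Arguments.
Unset Strict Implicit.
Unset Printing Implicit Defensive.
Import Order.TTheory GRing.Theory Num.Theory.
Local Open Scope ring_scope.

(** * Positive definite matrices *)

Section PositiveDefinite.
Variable F : realFieldType.

Definition qform n (A : 'M[F]_n) (v : 'cV_n) : F := \tr (v^T *m A *m v).

Definition posdef n (A : 'M[F]_n) : Prop :=
  A^T = A /\ forall v : 'cV_n, v != 0 -> 0 < qform A v.

Definition possemidef n (A : 'M[F]_n) : Prop :=
  A^T = A /\ forall v : 'cV_n, 0 <= qform A v.

Lemma qformD n (A B : 'M[F]_n) v : qform (A + B) v = qform A v + qform B v.
Proof. by rewrite /qform mulmxDr mulmxDl mxtraceD. Qed.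

Lemma qformZ n a (A : 'M[F]_n) v : qform (a *: A) v = a * qform A v.
Proof. by rewrite /qform -scalemxAr -scalemxAl mxtraceZ. Qed.

Lemma qformN n (A : 'M[F]_n) v : qform (- A) v = - qform A v.
Proof. by rewrite -scaleN1r qformZ mulN1r. Qed.

Lemma qform_opp n (A : 'M[F]_n) v : qform A (- v) = qform A v.
Proof.
have vN : (- v)^T = - v^T by rewrite linearN.
by rewrite /qform vN mulmxN !mulNmx opprK.
Qed.

Lemma qform_scalar n a (v : 'cV[F]_n) : qform a%:M v = a * \tr (v^T *m v).
Proof. by rewrite -scalemx1 qformZ /qform mulmx1. Qed.

Lemma qform_tr n (A : 'M[F]_n) v : qform A v = \tr (A *m (v *m v^T)).
Proof. by rewrite /qform -mulmxA mxtrace_mulC !mulmxA. Qed.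

Lemma qform_gram m n (B : 'M[F]_(m, n)) v :
  qform (B^T *m B) v = \tr ((B *m v)^T *m (B *m v)).
Proof. by rewrite /qform trmx_mul !mulmxA. Qed.

Lemma tr_gram m n (A : 'M[F]_(m, n)) : \tr (A^T *m A) = \sum_j \sum_i A i j ^+ 2.
Proof.
apply: eq_bigr => j _; rewrite mxE; apply: eq_bigr => i _.
by rewrite mxE expr2.
Qed.

Lemma tr_gram_ge0 m n (A : 'M[F]_(m, n)) : 0 <= \tr (A^T *m A).
Proof. by rewrite tr_gram !sumr_ge0 // => j _; rewrite sumr_ge0 // => i _; rewrite sqr_ge0. Qed.

Lemma tr_gram_gt0 n (v : 'cV[F]_n) : v != 0 -> 0 < \tr (v^T *m v).
Proof.
move=> v0; rewrite lt_def tr_gram_ge0 andbT; apply: contra v0.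
rewrite tr_gram big_ord1 psumr_eq0 => [/allP h|i _]; last exact: sqr_ge0.
apply/eqP/colP => i; rewrite mxE; apply/eqP; rewrite -(sqrf_eq0 (v i 0)).
by apply: h; rewrite mem_index_enum.
Qed.

Lemma posdef_semi n (A : 'M[F]_n) : posdef A -> possemidef A.
Proof.
case=> sA pA; split=> // v; have [->|/pA/ltW //] := eqVneq v 0.
by rewrite /qform mulmx0 mxtrace0.
Qed.

Lemma posdefD_semi n (A B : 'M[F]_n) : posdef A -> possemidef B -> posdef (A + B).
Proof.
move=> [sA pA] [sB pB]; split=> [|v v0]; first by rewrite linearD /= sA sB.
by rewrite qformD ltr_wpDr ?pA.
Qed.

Lemma posdefD n (A B : 'M[F]_n) : posdef A -> posdef B -> posdef (A + B).
Proof. by move=> pA /posdef_semi; exact: posdefD_semi. Qed.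

Lemma posdefZ n a (A : 'M[F]_n) : 0 < a -> posdef A -> posdef (a *: A).
Proof.
move=> a0 [sA pA]; split=> [|v v0]; first by rewrite linearZ /= sA.
by rewrite qformZ mulr_gt0 ?pA.
Qed.

Lemma possemidef_scalar n a : 0 <= a -> possemidef (a%:M : 'M[F]_n).
Proof.
move=> a0; split=> [|v]; first exact: tr_scalar_mx.
by rewrite qform_scalar mulr_ge0 ?tr_gram_ge0.
Qed.

Lemma posdef_unit n (A : 'M[F]_n) : posdef A -> A \in unitmx.
Proof.
case=> sA pA; rewrite -row_free_unit -kermx_eq0; apply: contraT => /rowV0Pn[v].
rewrite sub_kermx => /eqP vA v0; have := pA v^T.
by rewrite /qform trmxK vA mul0mx mxtrace0 ltxx trmx_eq0 => /(_ v0).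
Qed.

Lemma posdef_inv n (A : 'M[F]_n) : posdef A -> posdef (invmx A).
Proof.
move=> pA; have uA := posdef_unit pA; case: pA => sA pA.
have sI : (invmx A)^T = invmx A by rewrite trmx_inv sA.
split=> // v v0.
have -> : qform (invmx A) v = qform A (invmx A *m v).
  by rewrite /qform trmx_mul sI -!mulmxA (mulKVmx uA).
apply: pA; apply: contra v0 => /eqP h; apply/eqP.
by rewrite -(mulKVmx uA v) h mulmx0.
Qed.

Lemma posdef_sqr n (A : 'M[F]_n) : posdef A -> posdef (A *m A).
Proof.
move=> pA; have uA := posdef_unit pA; case: pA => sA pA.
split=> [|v v0]; first by rewrite trmx_mul sA.
rewrite -{1}sA qform_gram; apply: tr_gram_gt0; apply: contra v0 => /eqP h.
by apply/eqP; rewrite -(mulKmx uA v) h mulmx0.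
Qed.

(** Induction on the size. Eliminating the first coordinate writes [P] as [a^-1 z z^T] plus the
    Schur complement [S] padded by zeros: the first term contributes [qform Q z / a], the second a
    smaller instance of the claim. This avoids square roots and diagonalization, so it works over
    any ordered field. *)
Lemma mxtrace_mul_ge0 n (P Q : 'M[F]_n) :
  posdef P -> possemidef Q -> 0 <= \tr (P *m Q).
Proof.
elim: n P Q => [|n IHn] P Q [sP pP] [sQ pQ].
  by rewrite /mxtrace big_ord0.
rewrite -[n.+1]/(1 + n)%N in P Q sP pP sQ pQ *.
pose a := P 0 0; pose b := dlsubmx P.
have Pul : ulsubmx P = a%:M.
  by rewrite [ulsubmx P]mx11_scalar /ulsubmx !mxE lshift0.
have Pur : ursubmx P = b^T by rewrite /b trmx_dlsub sP.
pose S := drsubmx P - a^-1 *: (b *m b^T); pose z : 'cV_(1 + n) := col_mx a%:M b.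
have a0 : 0 < a.
  have := pP (col_mx 1%:M 0).
  rewrite /qform -{1}[P]submxK Pul tr_col_mx tr_scalar_mx trmx0.
  rewrite mul_row_block mul_row_col !mul0mx !addr0 mulmx0 addr0 mul1mx mulmx1.
  rewrite mxtrace_scalar mulr1n; apply.
  by rewrite col_mx_eq0 negb_and; apply/orP; left; exact: oner_neq0.
have PE : P = a^-1 *: (z *m z^T) + block_mx 0 0 0 S.
  rewrite tr_col_mx tr_scalar_mx mul_col_row scale_block_mx add_block_mx !addr0.
  rewrite -scalar_mxM scale_scalar_mx mulKf ?gt_eqF //.
  rewrite mul_mx_scalar mul_scalar_mx !scalerA mulVf ?gt_eqF // !scale1r.
  by rewrite /S addrCA subrr addr0 -Pul -Pur submxK.
have pS : posdef S.
  split=> [|v v0].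
    rewrite linearB /= linearZ /= trmx_mul trmxK; congr (_ - _).
    by rewrite trmx_drsub sP.
  (* [y] extends [v] so as to be orthogonal to [z]; the rank-one term then vanishes and
     [qform P y = qform S v]. *)
  pose y : 'cV_(1 + n) := col_mx (- a^-1 *: (b^T *m v)) v.
  have zy : z^T *m y = 0.
    rewrite tr_col_mx tr_scalar_mx mul_row_col mul_scalar_mx scalerA mulrN.
    by rewrite divff ?gt_eqF // scaleN1r addNr.
  have : 0 < qform P y.
    by apply: pP; rewrite col_mx_eq0 negb_and v0 orbT.
  rewrite PE qformD qformZ {1}/qform -!mulmxA zy !mulmx0 mxtrace0 mulr0 add0r.
  rewrite /qform tr_col_mx mul_row_block !mulmx0 !add0r mul_row_col mul0mx add0r.
  by [].
rewrite {1}PE mulmxDl mxtraceD addr_ge0 //.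
  rewrite -scalemxAl mxtraceZ mulr_ge0 ?invr_ge0 ?(ltW a0) //.
  by rewrite mxtrace_mulC -qform_tr.
rewrite -[Q]submxK mulmx_block !mul0mx !add0r mxtrace_block mxtrace0 add0r.
apply: IHn => //; split=> [|v]; first by rewrite trmx_drsub sQ.
have := pQ (col_mx 0 v).
rewrite /qform -{1}[Q]submxK tr_col_mx trmx0 mul_row_block !mul0mx !add0r.
by rewrite mul_row_col mulmx0 add0r.
Qed.

Lemma mxtrace_possemidef_ge0 n (A : 'M[F]_n) : possemidef A -> 0 <= \tr A.
Proof.
move=> psA; rewrite -(mul1mx A); apply: mxtrace_mul_ge0 => //.
split=> [|v v0]; first exact: tr_scalar_mx.
by rewrite qform_scalar mul1r tr_gram_gt0.
Qed.

(** This is convexity of [d |-> tr (A + d)^-1], whose derivative is [- tr (A + d)^-2]. Using the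
    resolvent identity [eq1] twice shows that the two sides differ by [d^2 tr (B^-1 A^-1 B^-1)]. *)
Lemma mxtrace_invmx_shift n (A : 'M[F]_n) d : posdef A -> 0 <= d ->
  \tr (invmx (A + d%:M)) + d * \tr (invmx (A + d%:M) *m invmx (A + d%:M))
    <= \tr (invmx A).
Proof.
move=> pA d0; set B := A + d%:M.
have pB : posdef B by apply: posdefD_semi => //; apply: possemidef_scalar.
have uA := posdef_unit pA; have uB := posdef_unit pB.
have sIB : (invmx B)^T = invmx B by case: (posdef_inv pB).
have eq1 : invmx A - invmx B = d *: (invmx A *m invmx B).
  have : invmx A *m (B - A) *m invmx B = d *: (invmx A *m invmx B).
    by rewrite /B addrC addKr mul_mx_scalar -scalemxAl.
  by rewrite mulmxBr mulmxBl (mulVmx uA) mul1mx (mulmxK uB).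
have eq2 : \tr (invmx A) - \tr (invmx B) - d * \tr (invmx B *m invmx B)
    = d * (d * \tr (invmx B *m invmx A *m invmx B)).
  rewrite -raddfB /= eq1 mxtraceZ -mulrBr -raddfB /= -mulmxBl eq1.
  by rewrite -scalemxAl mxtraceZ (mxtrace_mulC _ (invmx B)) !mulmxA.
have : 0 <= d * (d * \tr (invmx B *m invmx A *m invmx B)).
  rewrite !mulr_ge0 // mxtrace_mulC mulmxA mxtrace_mulC.
  apply: mxtrace_mul_ge0; first exact: posdef_inv.
  by apply/posdef_semi/posdef_sqr/posdef_inv.
rewrite -eq2; lra.
Qed.

Section Bordered.
Variables (n : nat) (A : 'M[F]_n) (w : 'cV[F]_n) (d : F).
Hypothesis pA : posdef A.
(** The Schur complement of [A] in [P]. *)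
Let s := d - qform (invmx A) w.
Hypothesis s_gt0 : 0 < s.
Let P : 'M_(1 + n) := block_mx d%:M w^T w A.

Let qformE : w^T *m invmx A *m w = (d - s)%:M.
Proof.
rewrite [LHS]mx11_scalar /s /qform [_ *m w]mx11_scalar mxtrace_scalar mulr1n.
by rewrite !mxE eqxx mulr1n opprB addrC subrK.
Qed.

Lemma posdef_bordered : posdef P.
Proof.
have uA := posdef_unit pA; have [sA qA] := pA; have [sI qI] := posdef_inv pA.
split=> [|v v0].
  by rewrite tr_block_mx tr_scalar_mx trmxK sA.
rewrite -[v]vsubmxK in v0 *.
set x := usubmx v in v0 *; set y := dsubmx v in v0 *.
rewrite [x]mx11_scalar in v0 *; set t := x 0 0 in v0 *.
(* Completing the square in [y] decouples the new coordinate [t] from [A]. *)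
pose y' := y + t *: (invmx A *m w).
have -> : qform P (col_mx t%:M y) = s * t ^+ 2 + qform A y'.
  rewrite /qform tr_col_mx tr_scalar_mx mul_row_block mul_row_col.
  rewrite /y' [(y + _)^T]linearD /= linearZ /= trmx_mul sI.
  have -> : (y^T + t *: (w^T *m invmx A)) *m A = y^T *m A + t *: w^T.
    by rewrite mulmxDl -scalemxAl mulmxKV.
  rewrite [in RHS]mulmxDr !mulmxDl -!scalemxAr -!scalemxAl !mulmxA.
  rewrite (mulmxK uA) qformE !mul_scalar_mx !mul_mx_scalar -!scalemxAl.
  rewrite !mxtraceD !mxtraceZ !mxtrace_scalar !mulr1n.
  ring.
have [t0|t0] := eqVneq t 0; last first.
  apply: ltr_pwDl; last by have [_ psA] := posdef_semi pA; exact: psA.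
  by rewrite mulr_gt0 // exprn_even_gt0.
rewrite t0 expr0n mulr0 add0r; apply: qA.
rewrite /y' t0 scale0r addr0; apply: contra v0 => /eqP ->.
by rewrite t0 raddf0 col_mx0.
Qed.

Lemma mxtrace_invmx_bordered :
  \tr (invmx P) = \tr (invmx A) + (1 + qform (invmx A *m invmx A) w) / s.
Proof.
have uA := posdef_unit pA; have [sI _] := posdef_inv pA.
(* The inverse of [P] in block form, obtained by eliminating [A]. *)
pose Q : 'M_(1 + n) := block_mx (s^-1)%:M (- s^-1 *: (w^T *m invmx A))
  (- s^-1 *: (invmx A *m w)) (invmx A + s^-1 *: (invmx A *m w *m w^T *m invmx A)).
have PQ : P *m Q = 1%:M.
  rewrite mulmx_block [RHS]scalar_mx_block; congr block_mx.
  - rewrite -scalar_mxM -scalemxAr mulmxA qformE scale_scalar_mx -raddfD /=.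
    congr _%:M; field; exact: lt0r_neq0.
  - rewrite mulmxDr -!scalemxAr !mulmxA qformE !mul_scalar_mx -!scalemxAl.
    rewrite !scalerA -{2}[w^T *m _]scale1r -!scalerDl.
    rewrite [X in X *: _](_ : _ = 0) ?scale0r //; field; exact: lt0r_neq0.
  - by rewrite mul_mx_scalar -scalemxAr mulKVmx // scaleNr subrr.
  - rewrite mulmxDr -!scalemxAr !mulmxA mulmxV // mul1mx.
    by rewrite scaleNr addrCA addNr addr0.
have uP := posdef_unit posdef_bordered.
have -> : invmx P = Q by rewrite -[Q](mulKmx uP) PQ mulmx1.
rewrite mxtrace_block mxtrace_scalar mulr1n mxtraceD mxtraceZ.
have -> : \tr (invmx A *m w *m w^T *m invmx A) = qform (invmx A *m invmx A) w.
  by rewrite qform_tr mxtrace_mulC !mulmxA.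
field; exact: lt0r_neq0.
Qed.

End Bordered.
End PositiveDefinite.

(** * Selecting columns under a barrier *)

Section ColumnSelection.
Variables (F : realFieldType) (n p : nat) (X : 'M[F]_(n, p)).

(* [u - H] and [u + H] for [H = Y^T Y - 1]. *)
Definition upper_gap r u (Y : 'M[F]_(n, r)) : 'M_r := (1 + u)%:M - Y^T *m Y.
Definition lower_gap r u (Y : 'M[F]_(n, r)) : 'M_r := (u - 1)%:M + Y^T *m Y.

Definition potential r u (Y : 'M[F]_(n, r)) : F :=
  \tr (invmx (upper_gap u Y)) + \tr (invmx (lower_gap u Y)).

Lemma upper_gapD r u d (Y : 'M[F]_(n, r)) :
  upper_gap (u + d) Y = upper_gap u Y + d%:M.
Proof. by rewrite /upper_gap addrA raddfD /= addrAC. Qed.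

Lemma lower_gapD r u d (Y : 'M[F]_(n, r)) :
  lower_gap (u + d) Y = lower_gap u Y + d%:M.
Proof. by rewrite /lower_gap addrAC raddfD /= addrAC. Qed.

Hypothesis unitX : forall j, \tr ((col j X)^T *m col j X) = 1.
Variable L : F.
Hypothesis trX_bound : forall y : 'cV_n,
  \tr ((X^T *m y)^T *m (X^T *m y)) <= L * \tr (y^T *m y).

Lemma gram_cons r j (Y : 'M[F]_(n, r)) :
  (row_mx (col j X) Y)^T *m row_mx (col j X) Y =
  block_mx 1%:M (Y^T *m col j X)^T (Y^T *m col j X) (Y^T *m Y) :> 'M_(1 + r).
Proof.
rewrite tr_row_mx mul_col_row trmx_mul trmxK; congr block_mx.
by rewrite [LHS]mx11_scalar -(unitX j) [_ *m col j X]mx11_scalar mxtrace_scalar !mxE eqxx !mulr1n.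
Qed.

Lemma upper_gap_cons r u j (Y : 'M[F]_(n, r)) :
  upper_gap u (row_mx (col j X) Y) =
  block_mx u%:M (- (Y^T *m col j X))^T (- (Y^T *m col j X)) (upper_gap u Y) :> 'M_(1 + r).
Proof.
rewrite /upper_gap gram_cons [(1 + u)%:M]scalar_mx_block opp_block_mx add_block_mx.
by rewrite !add0r -raddfB /= addrAC subrr add0r linearN.
Qed.

Lemma lower_gap_cons r u j (Y : 'M[F]_(n, r)) :
  lower_gap u (row_mx (col j X) Y) =
  block_mx u%:M (Y^T *m col j X)^T (Y^T *m col j X) (lower_gap u Y) :> 'M_(1 + r).
Proof.
rewrite /lower_gap gram_cons [(u - 1)%:M]scalar_mx_block add_block_mx.
by rewrite !add0r -raddfD /= subrK.
Qed.

(* Averaging over the columns: the mean of [qform M (Y^T x)] is [\tr (M Z) / p]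
   with [Z = Y^T X X^T Y <= L (1 + u)] in the semidefinite order. *)
Lemma exists_column r u (Y : 'M[F]_(n, r)) (M : 'M[F]_r) :
  (0 < p)%N -> 0 <= L -> posdef (upper_gap u Y) -> posdef M ->
  exists j, p%:R * qform M (Y^T *m col j X) <= L * (1 + u) * \tr M.
Proof.
move=> p0 L0 pU pM.
have sumE : \sum_j qform M (Y^T *m col j X) = \tr (M *m (Y^T *m X *m (Y^T *m X)^T)).
  under eq_bigr do rewrite colE mulmxA -colE.
  move: (Y^T *m X) => W; rewrite mulmxA mxtrace_mulC mulmxA; apply: eq_bigr => j _.
  rewrite /qform /mxtrace big_ord1 !mxE; apply: eq_bigr => a _; rewrite !mxE.
  by congr (_ * _); apply: eq_bigr => b _; rewrite !mxE.
have le_sum : \sum_j qform M (Y^T *m col j X) <= L * (1 + u) * \tr M.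
  rewrite sumE -mxtraceZ -mul_mx_scalar -subr_ge0 -raddfB /= -mulmxBr.
  apply: mxtrace_mul_ge0 => //; split=> [|v].
    by rewrite linearB /= tr_scalar_mx !trmx_mul !trmxK !mulmxA.
  (* In norms: [|X^T Y v|^2 <= L |Y v|^2 <= L (1 + u) |v|^2], the last step because [upper_gap u Y]
     is positive. *)
  rewrite qformD qformN qform_scalar.
  have -> : qform (Y^T *m X *m (Y^T *m X)^T) v
      = \tr ((X^T *m (Y *m v))^T *m (X^T *m (Y *m v))).
    by rewrite /qform !trmx_mul !trmxK !mulmxA.
  rewrite subr_ge0; apply: le_trans (trX_bound _) _.
  rewrite -mulrA ler_wpM2l //.
  have [_ /(_ v)] := posdef_semi pU.
  by rewrite qformD qformN qform_scalar qform_gram subr_ge0.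
case: (boolP [exists j, p%:R * qform M (Y^T *m col j X) <= L * (1 + u) * \tr M]).
  by move/existsP.
move=> /existsPn h; suff : \sum_(j < p) L * (1 + u) * \tr M
    < \sum_j p%:R * qform M (Y^T *m col j X).
  rewrite -mulr_sumr sumr_const card_ord -[_ *+ p]mulr_natl.
  by rewrite ltr_pM2l ?ltr0n // ltNge le_sum.
apply: ltr_sum => [|j _]; last by rewrite ltNge h.
by apply/hasP; exists (Ordinal p0); rewrite ?mem_index_enum.
Qed.

(** The last column only has to preserve positivity, so the barrier stays at [u]; averaging the sum
    of the two inverses makes both Schur complements positive at once. *)
Lemma extend_last r u (Y : 'M[F]_(n, r)) :
  (0 < p)%N -> 0 <= L -> posdef (upper_gap u Y) -> posdef (lower_gap u Y) ->
  L * (1 + u) * potential u Y < p%:R * u ->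
  exists j, posdef (upper_gap u (row_mx (col j X) Y)) /\
            posdef (lower_gap u (row_mx (col j X) Y)).
Proof.
move=> p0 L0 pU pW small.
have pIU := posdef_inv pU; have pIW := posdef_inv pW.
have [j] := exists_column p0 L0 pU (posdefD pIU pIW).
rewrite mxtraceD qformD => hj; exists j.
have : qform (invmx (upper_gap u Y)) (Y^T *m col j X)
     + qform (invmx (lower_gap u Y)) (Y^T *m col j X) < u.
  by rewrite -(ltr_pM2l (_ : 0 < p%:R)) ?ltr0n //; apply: le_lt_trans hj small.
have [_ /(_ (Y^T *m col j X)) U0] := posdef_semi pIU.
have [_ /(_ (Y^T *m col j X)) W0] := posdef_semi pIW.
move=> lt_u; rewrite upper_gap_cons lower_gap_cons; split; apply: posdef_bordered => //.
  by rewrite qform_opp; lra.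
lra.
Qed.

(** Positive Schur complements and bounded growth of the potential both follow from one inequality
    that is linear in the quadratic forms of the new column, so a single average provides the
    column. *)
Lemma extend_step r u d eps (Y : 'M[F]_(n, r)) :
  (0 < p)%N -> 0 < L -> 0 < d -> 0 < 1 + eps -> u + d <= eps ->
  posdef (upper_gap u Y) -> posdef (lower_gap u Y) ->
  let m := L * (1 + eps) / p%:R in
  m <= (u + d - m * potential u Y) * d ->
  exists j, let Y' : 'M_(n, 1 + r) := row_mx (col j X) Y in
    [/\ posdef (upper_gap (u + d) Y'), posdef (lower_gap (u + d) Y') &
        m * potential (u + d) Y' <= m * potential u Y + 2 * d].
Proof.
move=> p0 L0 d0 e0 ude pU pW m room.
have pr0 : 0 < p%:R :> F by rewrite ltr0n.
have m0 : 0 < m by rewrite divr_gt0 ?mulr_gt0.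
have pD : possemidef (d%:M : 'M[F]_r) by apply: possemidef_scalar; apply: ltW.
have pU' : posdef (upper_gap (u + d) Y) by rewrite upper_gapD; apply: posdefD_semi.
have pW' : posdef (lower_gap (u + d) Y) by rewrite lower_gapD; apply: posdefD_semi.
have dropU := mxtrace_invmx_shift pU (ltW d0).
have dropW := mxtrace_invmx_shift pW (ltW d0).
rewrite -upper_gapD in dropU; rewrite -lower_gapD in dropW.
set U := upper_gap (u + d) Y in pU' dropU *.
set W := lower_gap (u + d) Y in pW' dropW *.
have pIU := posdef_inv pU'; have pIW := posdef_inv pW'.
have pIU2 := posdef_sqr pIU; have pIW2 := posdef_sqr pIW.
set IU := invmx U in pIU pIU2 dropU *; set IW := invmx W in pIW pIW2 dropW *.
pose S := \tr (IU *m IU) + \tr (IW *m IW).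
have S0 : 0 <= S by rewrite addr_ge0 // mxtrace_possemidef_ge0 //; apply: posdef_semi.
(* [y] is the allowed increase of the potential: [d * S] is what the shift of the
   barrier by [d] gained. *)
pose y := d * S + 2 * d / m.
have y0 : 0 < y by rewrite ltr_wpDl ?divr_gt0 ?mulr_gt0 ?mulr_ge0 // ltW.
(* With this weight, [2 + qform M w <= (u + d) * y] is the same as [sy], which bounds the total
   increase by [y]. *)
pose M := (IU *m IU + IW *m IW) + y *: (IU + IW).
have pM : posdef M by apply: posdefD; [|apply: posdefZ => //]; apply: posdefD.
have [j] := exists_column p0 (ltW L0) pU' pM.
set w := Y^T *m col j X => hj.
have trM0 : 0 <= \tr M by apply: mxtrace_possemidef_ge0; apply: posdef_semi.
have {}hj : qform M w <= m * \tr M.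
  rewrite -(ler_pM2l pr0); apply: le_trans hj _.
  rewrite /m mulrA [p%:R * _]mulrCA divff ?gt_eqF // mulr1.
  by rewrite ler_wpM2r // ler_wpM2l ?(ltW L0) // lerD2l.
have [_ /(_ w) aU0] := posdef_semi pIU; have [_ /(_ w) aW0] := posdef_semi pIW.
have [_ /(_ w) bU0] := posdef_semi pIU2; have [_ /(_ w) bW0] := posdef_semi pIW2.
move: hj; rewrite !qformD qformZ qformD !mxtraceD mxtraceZ mxtraceD -/S.
set aU := qform IU w in aU0 *; set aW := qform IW w in aW0 *.
set bU := qform _ w in bU0 *; set bW := qform _ w in bW0 *.
set t := \tr IU + \tr IW; move=> hj.
(* The slack at the moved barrier. The hypothesis [room] is [m <= g * d]; multiplied by
   [S + 2 / m = y / d] it gives [h2]. *)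
pose g := u + d - m * potential u Y.
have gd : m <= g * d by [].
have t_le : t <= potential u Y - d * S.
  by rewrite /t /S /potential; lra.
have key : 2 + m * S + m * (y * t) <= (u + d) * y.
  have h1 : m * t <= u + d - g.
    have -> : u + d - g = m * potential u Y by rewrite /g; ring.
    by rewrite ler_pM2l //; apply: le_trans t_le _; rewrite gerBl mulr_ge0 // ltW.
  have h2 : 2 + m * S <= g * y.
    have -> : 2 + m * S = m * (S + 2 / m) by field; exact: lt0r_neq0.
    have -> : g * y = g * d * (S + 2 / m) by rewrite /y; field; exact: lt0r_neq0.
    by rewrite ler_wpM2r // addr_ge0 // divr_ge0 // ltW.
  by have := ler_wpM2l (ltW y0) h1; lra.
(* [s] is a lower bound for both Schur complements [u + d - aU] and [u + d - aW], hence a common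
   denominator for both increases. *)
pose s := u + d - (aU + aW).
have sy : 2 + (bU + bW) <= s * y by rewrite /s; nra.
have s0 : 0 < s by rewrite -(pmulr_lgt0 _ y0); lra.
have sU0 : 0 < u + d - aU by rewrite /s in s0; lra.
have sW0 : 0 < u + d - aW by rewrite /s in s0; lra.
exists j; rewrite /= /potential upper_gap_cons lower_gap_cons -/w -/U -/W.
split; [by apply: posdef_bordered; rewrite ?qform_opp | exact: posdef_bordered |].
rewrite !mxtrace_invmx_bordered ?qform_opp // -/IU -/IW -/aU -/aW -/bU -/bW.
have fU : (1 + bU) / (u + d - aU) <= (1 + bU) / s.
  by rewrite ler_wpM2l ?addr_ge0 // lef_pV2 ?posrE // /s; lra.
have fW : (1 + bW) / (u + d - aW) <= (1 + bW) / s.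
  by rewrite ler_wpM2l ?addr_ge0 // lef_pV2 ?posrE // /s; lra.
have fs : (1 + bU) / s + (1 + bW) / s <= y.
  by rewrite -mulrDl ler_pdivrMr // mulrC; lra.
have yE : m * y = m * (d * S) + 2 * d by rewrite /y; field; exact: lt0r_neq0.
(* The [d * S] inside [y] cancels against the drop recorded in [t_le]; the net increase is
   [2 * d / m]. *)
have : m * (t + y) <= m * (potential u Y + 2 * d / m).
  by rewrite ler_pM2l // /y; lra.
have -> : m * (potential u Y + 2 * d / m) = m * potential u Y + 2 * d.
  by field; exact: lt0r_neq0.
by apply: le_trans; rewrite ler_pM2l // /t; lra.
Qed.

Variable j0 : 'I_p.

Definition cols (T : seq 'I_p) : 'M[F]_(n, size T) := \matrix_(i, a) X i (nth j0 T a).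

Lemma cols_cons j T : cols (j :: T) = row_mx (col j X) (cols T) :> 'M_(n, 1 + size T).
Proof.
apply/matrixP => i a; rewrite !mxE; case: splitP => b; rewrite ?ord1 => ->; by rewrite mxE.
Qed.

(** The barrier starts at [eps - k d] and reaches [eps] after [k] uses of [extend_step];
    [extend_last] then adds column [k + 1] at the final barrier. *)
Lemma barrier_selection k eps d :
  0 < L -> 0 < d -> 0 < eps -> 2 * k%:R * d < eps ->
  let m := L * (1 + eps) / p%:R in
  m <= (eps - (2 * k%:R - 2) * d) * d ->
  exists T : seq 'I_p, size T = k.+1 /\
    posdef (upper_gap eps (cols T)) /\ posdef (lower_gap eps (cols T)).
Proof.
move=> L0 d0 e0 kd m room.
have p0 : (0 < p)%N by apply: leq_ltn_trans (ltn_ord j0).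
have e1 : 0 < 1 + eps by lra.
have m0 : 0 < m by rewrite divr_gt0 ?mulr_gt0 ?ltr0n.
have chain r : (r <= k)%N -> exists T : seq 'I_p, size T = r /\
    let u := eps - (k%:R - r%:R) * d in
    [/\ posdef (upper_gap u (cols T)), posdef (lower_gap u (cols T)) &
        m * potential u (cols T) <= 2 * r%:R * d].
  elim: r => [|r IHr] rk.
    (* With no columns the gaps are empty matrices: definiteness is vacuous and the potential is
       zero. *)
    exists [::]; split=> //=; split.
    - by split=> [|v]; [apply/matrixP; case|rewrite [v]flatmx0 eqxx].
    - by split=> [|v]; [apply/matrixP; case|rewrite [v]flatmx0 eqxx].
    - by rewrite /potential /mxtrace !big_ord0 addr0 !mulr0 mul0r.
  have [T [sT [pU pW pot]]] := IHr (ltnW rk).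
  set u := eps - _ in pU pW pot.
  have kr : r%:R + 1 <= k%:R :> F by rewrite natr1 ler_nat.
  have uE : eps - (k%:R - r.+1%:R) * d = u + d by rewrite /u -natr1; ring.
  have ude : u + d <= eps.
    by rewrite -uE gerBl mulr_ge0 ?(ltW d0) // subr_ge0 ler_nat.
  have [|j [pU' pW' pot']] := extend_step p0 L0 d0 e1 ude pU pW.
    (* The slack before adding column [r + 1] is at least [eps - (k + r - 1) d]; the worst case
       [r = k - 1] accounts for the [2 k - 2] in [room]. *)
    apply: le_trans room _; rewrite ler_wpM2r ?(ltW d0) // -/m.
    have : (r%:R + 1) * d <= k%:R * d by rewrite ler_wpM2r // ltW.
    by rewrite /u; lra.
  exists (j :: T); split; first by rewrite /= sT.
  rewrite cols_cons uE /=; split=> //.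
  by apply: le_trans pot' _; rewrite -/m -natr1; lra.
have [T [sT [pU pW pot]]] := chain k (leqnn k).
rewrite subrr mul0r subr0 in pU pW pot.
have [|j [pU' pW']] := extend_last p0 (ltW L0) pU pW.
  have -> : L * (1 + eps) = p%:R * m.
    by rewrite /m mulrCA divff ?mulr1 // pnatr_eq0 -lt0n.
  by rewrite -mulrA ltr_pM2l ?ltr0n //; apply: le_lt_trans pot kd.
by exists (j :: T); split; [rewrite /= sT | rewrite cols_cons].
Qed.

(* A repeated column would put [e_a - e_b] in the kernel of [cols T], where
   [lower_gap] is negative. *)
Lemma lower_gap_uniq u T : u <= 1 -> posdef (lower_gap u (cols T)) -> uniq T.
Proof.
move=> u1 [_ pW]; apply/(uniqP j0) => a b aT bT eq_ab; apply/eqP; apply: contraT => ab.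
pose v : 'cV[F]_(size T) := delta_mx (Ordinal aT) 0 - delta_mx (Ordinal bT) 0.
have Yv : cols T *m v = 0.
  rewrite mulmxBr -!colE; apply/colP => i.
  by rewrite !mxE /= eq_ab subrr.
have v0 : v != 0.
  apply: contra ab => /eqP/colP/(_ (Ordinal aT)); rewrite !mxE !eqxx /=.
  case: eqP => [[->] //|_] /eqP; by rewrite subr0 oner_eq0.
have := pW v v0; rewrite qformD qform_scalar qform_gram Yv mulmx0 mxtrace0 addr0.
rewrite pmulr_lgt0 ?tr_gram_gt0 // => ?; lra.
Qed.

(** On an eigenvector the two gaps take the values [(1 + u - l) |v|^2] and [(u - 1 + l) |v|^2]. *)
Lemma eigenvalue_bounds u r (Y : 'M[F]_(n, r)) (v : 'cV_r) l :
  posdef (upper_gap u Y) -> posdef (lower_gap u Y) ->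
  v != 0 -> Y^T *m Y *m v = l *: v -> 1 - u <= l <= 1 + u.
Proof.
move=> [_ pU] [_ pW] v0 eig; have := pU v v0; have := pW v v0.
have -> : lower_gap u Y = (u - 1)%:M + Y^T *m Y by [].
have -> : upper_gap u Y = (1 + u)%:M - Y^T *m Y by [].
rewrite !qformD qformN !qform_scalar.
have -> : qform (Y^T *m Y) v = l * \tr (v^T *m v).
  by rewrite /qform -mulmxA eig -scalemxAr mxtraceZ.
rewrite -mulrBl -mulrDl !(pmulr_lgt0 _ (tr_gram_gt0 v0)) => ? ?.
by apply/andP; split; lra.
Qed.

End ColumnSelection.

(** * Operator norm and eigenvalues *)

(** Over the complex numbers an eigenvalue [z] exists by algebraic closure. Pairing its eigenvector
    with the conjugate gives [(z^* - z) |v|^2 = 0], so [z] is real, and being an eigenvalue descends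
    to the real field. *)
Lemma symmetric_eigenvector (R : rcfType) n (A : 'M[R]_n) : (0 < n)%N -> A^T = A ->
  exists (l : R) (v : 'cV[R]_n), v != 0 /\ A *m v = l *: v.
Proof.
move=> n0 sA; pose f := real_complex R; pose AC := map_mx f A.
have [z /eigenvalueP[v vA v0]] := eigenvalue_closed AC n0.
have AC_conj : map_mx Num.conj AC = AC.
  apply/matrixP => i j; rewrite !mxE conj_Creal //.
  by apply/complex_realP; exists (A i j).
have Av : AC *m (map_mx Num.conj v)^T = z^* *: (map_mx Num.conj v)^T.
  have sAC : AC^T = AC by apply/matrixP => i j; rewrite !mxE -{1}sA mxE.
  by rewrite -[LHS]trmxK trmx_mul trmxK sAC -{1}AC_conj -map_mxM vA map_mxZ linearZ.
have zr : z \is Num.real.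
  apply/CrealP; apply/eqP; rewrite -subr_eq0.
  have : (z^* - z) *: (v *m (map_mx Num.conj v)^T) = 0.
    by rewrite scalerBl [z *: _]scalemxAl -vA -mulmxA Av -scalemxAr subrr.
  move/matrixP/(_ 0 0)/eqP; rewrite !mxE mulf_eq0 => /orP[//|].
  rewrite psumr_eq0 => [/allP h|i _]; last by rewrite !mxE mul_conjC_ge0.
  case/eqP: v0; apply/rowP => i; rewrite mxE; apply/eqP.
  by have := h i (mem_index_enum _); rewrite /= !mxE mul_conjC_eq0.
have /complex_realP[l zl] := zr.
have : eigenvalue AC (f l) by apply/eigenvalueP; exists v; rewrite ?vA ?zl.
rewrite eigenvalue_map => /eigenvalueP[u uA u0]; exists l, u^T.
by rewrite trmx_eq0 -{1}sA -trmx_mul uA linearZ.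
Qed.

(* [L *: y - X *m X^T *m y] has nonnegative norm: expanding its square gives
   [L * |X^T y|^2 <= L^2 * |y|^2]. *)
Lemma tr_bound_transpose (F : realFieldType) n p (X : 'M[F]_(n, p)) L : 0 < L ->
  (forall v : 'cV_p, \tr ((X *m v)^T *m (X *m v)) <= L * \tr (v^T *m v)) ->
  forall y : 'cV_n, \tr ((X^T *m y)^T *m (X^T *m y)) <= L * \tr (y^T *m y).
Proof.
move=> L0 bX y; set z := X^T *m y.
have sq := tr_gram_ge0 (X *m z - L *: y).
have zE : y^T *m X = z^T by rewrite /z trmx_mul trmxK.
have cross : \tr ((X *m z)^T *m y) = \tr (z^T *m z).
  by rewrite -mxtrace_tr trmx_mul trmxK mulmxA zE.
have cross' : \tr (y^T *m (X *m z)) = \tr (z^T *m z) by rewrite mulmxA zE.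
have LtrE : (L *: y)^T = L *: y^T by rewrite linearZ.
have := bX z.
move: sq; rewrite [(_ - _)^T]raddfB /= LtrE mulmxBl !mulmxBr.
rewrite -!scalemxAl -!scalemxAr !raddfB /= !mxtraceZ cross cross' => sq bz.
by rewrite -(ler_pM2l L0); lra.
Qed.

Lemma rsumE n (f : nat -> R) : rsum n f = \sum_(i < n) f i.
Proof. by elim: n => [|n IH]; rewrite ?big_ord0 // big_ord_recr /= IH. Qed.

Definition colv m (v : nat -> R) : 'cV[R]_m := \col_i v i.

Definition entry m (V : 'cV[R]_m) (k : nat) : R := oapp (fun i => V i 0) 0 (insub k).

Lemma colvK m (V : 'cV[R]_m) : colv m (entry V) = V.
Proof. by apply/colP => i; rewrite mxE /entry valK. Qed.

Lemma colv_mxv n p (X : nat -> nat -> R) v :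
  colv n (mxv n p X v) = (\matrix_(i < n, j < p) X i j) *m colv p v.
Proof.
by apply/colP => i; rewrite !mxE /mxv rsumE; apply: eq_bigr => j _; rewrite !mxE.
Qed.

Lemma tr_colv m v : \tr ((colv m v)^T *m colv m v) = \sum_(i < m) v i ^+ 2.
Proof. by rewrite tr_gram big_ord1; apply: eq_bigr => i _; rewrite mxE. Qed.

Lemma vnormE m v : vnorm m v = Num.sqrt (\tr ((colv m v)^T *m colv m v)).
Proof.
by rewrite /vnorm RsqrtE rsumE tr_colv; congr Num.sqrt; apply: eq_bigr => i _; rewrite RpowE.
Qed.

Lemma vnorm_ge0 m v : 0 <= vnorm m v.
Proof. by rewrite vnormE sqrtr_ge0. Qed.

Lemma sqr_vnorm m v : vnorm m v ^+ 2 = \tr ((colv m v)^T *m colv m v).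
Proof. by rewrite vnormE sqr_sqrtr // tr_gram_ge0. Qed.

Lemma vnormZ m c v : vnorm m (fun j => c * v j) = `|c| * vnorm m v.
Proof.
rewrite !vnormE !tr_colv; under eq_bigr do rewrite exprMn.
by rewrite -mulr_sumr sqrtrM ?sqr_ge0 // sqrtr_sqr.
Qed.

(** The choice operator in [opnorm] returns the true supremum once the set is shown bounded and
    nonempty. *)
Lemma opnorm_is_lub n p X :
  is_lub (fun y => exists v, Rle (vnorm p v) 1 /\ y = vnorm n (mxv n p X v)) (opnorm n p X).
Proof.
apply: epsilon_spec; set E := (X in is_lub X).
have bE : bound E.
  (* Entries of a vector in the unit ball are at most 1 in absolute value, so each coordinate of the
     image is bounded by the absolute row sum. *)
  exists (Num.sqrt (\sum_(i < n) (\sum_(j < p) `|X i j|) ^+ 2)) => _ [v [/RleP v1 ->]].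
  apply/RleP; rewrite vnormE ler_wsqrtr // tr_colv; apply: ler_sum => i _.
  rewrite -(real_normK (num_real _)) ler_sqr ?nnegrE ?sumr_ge0 // /mxv rsumE.
  apply: le_trans (ler_norm_sum _ _ _) _; apply: ler_sum => j _.
  rewrite normrM ler_piMr //.
  rewrite -ler_sqr ?nnegrE // expr1n real_normK ?num_real //.
  apply: (@le_trans _ _ (vnorm p v ^+ 2)); last by rewrite expr_le1 ?vnorm_ge0.
  rewrite sqr_vnorm tr_colv (bigD1 j) //= lerDl sumr_ge0 // => k _.
  exact: sqr_ge0.
have nE : exists x, E x.
  exists (vnorm n (mxv n p X (fun=> 0))), (fun=> 0); split=> //; apply/RleP.
  rewrite vnormE tr_colv big1 ?sqrtr0 ?ler01 // => i _.
  by rewrite expr0n.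
by have [m hm] := completeness E bE nE; exists m.
Qed.

(** By homogeneity, a nonzero [v] is rescaled to norm 1, where the supremum applies. *)
Lemma opnorm_bound n p X (v : nat -> R) :
  vnorm n (mxv n p X v) <= opnorm n p X * vnorm p v.
Proof.
have [ub _] := opnorm_is_lub n p X.
have mxvZ c w : vnorm n (mxv n p X (fun j => c * w j)) = `|c| * vnorm n (mxv n p X w).
  rewrite -vnormZ !vnormE (_ : colv n _ = colv n (fun i => c * mxv n p X w i)) //.
  apply/colP => i; rewrite !mxE /mxv !rsumE mulr_sumr; apply: eq_bigr => j _.
  exact: mulrCA.
have [v0|v0] := eqVneq (vnorm p v) 0.
  have colv0 : colv p v = 0.
    apply/eqP; apply: contraTT isT => /tr_gram_gt0.
    by rewrite -sqr_vnorm v0 expr0n ltxx.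
  by rewrite v0 mulr0 vnormE colv_mxv colv0 !mulmx0 mxtrace0 sqrtr0.
have vp : 0 < vnorm p v by rewrite lt_def v0 vnorm_ge0.
rewrite -ler_pdivrMr // mulrC -[_^-1]gtr0_norm ?invr_gt0 // -mxvZ.
apply/RleP/ub; eexists; split; last by [].
by rewrite vnormZ gtr0_norm ?invr_gt0 // mulVf //; apply: Rle_refl.
Qed.

Lemma nthE (T : Type) (x : T) s i : List.nth i s x = seq.nth x s i.
Proof. by elim: s i => [|y s IH] [|i] //=. Qed.

Lemma uniq_NoDup (s : seq nat) : uniq s -> NoDup s.
Proof.
elim: s => [|x s IH] /=; first by constructor.
move=> /andP[xs /IH ds]; constructor=> // {IH ds} xin; move/negP: xs; apply.
elim: s xin => //= y s IH [->|/IH ys]; first by rewrite inE eqxx.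
by rewrite inE ys orbT.
Qed.

Lemma is_eigenvalueP m (A : nat -> nat -> R) l :
  is_eigenvalue m A l <->
  exists2 v : 'cV[R]_m, v != 0 & (\matrix_(i, j) A i j) *m v = l *: v.
Proof.
split=> [[v [[k [/ssrnat.ltP km vk] eig]]]|[v v0 eig]].
  exists (colv m v).
    by apply/eqP => /colP/(_ (Ordinal km)); rewrite !mxE.
  apply/colP => a; rewrite !mxE; apply: etrans (eig a _); last exact/ssrnat.ltP.
  by rewrite rsumE; apply: eq_bigr => b _; rewrite !mxE.
exists (entry v); split.
  have [i vi] : exists i, v i 0 != 0 by apply/cV0Pn.
  by exists i; split; [apply/ssrnat.ltP | rewrite /entry valK; apply/eqP].
move=> a /ssrnat.ltP am; rewrite rsumE; have /colP/(_ (Ordinal am)) := eig.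
rewrite !mxE /entry insubT /= => h; apply: etrans h; apply: eq_bigr => b _.
by rewrite !mxE valK.
Qed.

(** A nonempty bounded set of eigenvalues makes the chosen values the true infimum and supremum. The
    infimum comes from completeness applied to the reflected set. *)
Lemma extreme_eigenvalues m (A : nat -> nat -> R) a b :
  (exists l, is_eigenvalue m A l) ->
  (forall l, is_eigenvalue m A l -> (a <= l <= b)) ->
  Rle a (lambda_min m A) /\ Rle (lambda_min m A) (lambda_max m A)
  /\ Rle (lambda_max m A) b.
Proof.
move=> [l0 El0] ab.
have [ubM leM] : is_lub (is_eigenvalue m A) (lambda_max m A).
  apply: epsilon_spec; case: (completeness (is_eigenvalue m A)).
  - by exists b => l /ab/andP[_ /RleP].
  - by exists l0.
  - by move=> x lubx; exists x.
have [lbm gem] : is_glb (is_eigenvalue m A) (lambda_min m A).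
  apply: epsilon_spec; case: (completeness (fun x => is_eigenvalue m A (GRing.opp x))).
  - by exists (- a) => l /ab/andP[al _]; apply/RleP; rewrite lerNr.
  - by exists (- l0); rewrite opprK.
  - move=> x [ubx lex]; exists (- x); split=> [l El|c lbc].
      have /RleP : Rle (GRing.opp l) x by apply: ubx; rewrite opprK.
      by move=> h; apply/RleP; rewrite lerNl.
    have /RleP : Rle x (GRing.opp c).
      by apply: lex => l /lbc/RleP h; apply/RleP; rewrite lerNr.
    by move=> h; apply/RleP; rewrite lerNr.
split; first by apply: gem => l /ab/andP[/RleP].
split; last by apply: leM => l /ab/andP[_ /RleP].
exact: Rle_trans (lbm _ El0) (ubM _ El0).
Qed.

(** * Choice of the step size and conclusion *)

Lemma barrier_room (F : realFieldType) (k eps m l : F) :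
  0 < k -> 0 < m -> 2 * k / (k + 2) <= l -> (k + 1) * l <= eps ^+ 2 / (4 * m) ->
  m <= (eps - (2 * k - 2) * (eps / (4 * k))) * (eps / (4 * k)).
Proof.
(* Here [l] stands for [ln (k + 1)]. The hypotheses give [m <= eps^2 (k + 2) / (8 k (k + 1))], while
   the right-hand side equals [eps^2 (k + 1) / (8 k^2)]; what remains is
   [k (k + 2) <= (k + 1)^2]. *)
move=> k0 m0 lk /(le_trans (ler_wpM2l (addr_ge0 (ltW k0) ler01) lk)) h.
have k1 : 0 < k + 1 by rewrite addr_gt0.
have k2 : 0 < k + 2 by rewrite addr_gt0.
have {}h : (k + 1) * (2 * k) * (4 * m) <= eps ^+ 2 * (k + 2).
  have E : (k + 1) * (2 * k / (k + 2)) * (4 * m) = (k + 1) * (2 * k) * (4 * m) / (k + 2).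
    by ring.
  by move: h; rewrite ler_pdivlMr ?mulr_gt0 // E ler_pdivrMr.
have -> : (eps - (2 * k - 2) * (eps / (4 * k))) * (eps / (4 * k))
    = eps ^+ 2 * (k + 1) / (8 * k ^+ 2) by field; exact: lt0r_neq0.
rewrite ler_pdivlMr ?mulr_gt0 ?exprn_gt0 // -(ler_pM2r k1).
have := ler_wpM2l (ltW k0) h; have := sqr_ge0 eps; lra.
Qed.

Lemma selection_of_opnorm n p (X : nat -> nat -> R) eps k :
  (0 < p)%N -> (forall j, (j < p)%N -> vnorm n (fun i => X i j) = 1) ->
  0 < eps < 1 ->
  k.+1%:R * ln k.+1%:R <= eps ^+ 2 / (4 * (1 + eps)) * (p%:R / opnorm n p X ^+ 2) ->
  exists T : seq 'I_p, [/\ size T = k.+1, uniq T &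
    let G := gramT n X (map val T) in
    (exists l, is_eigenvalue k.+1 G l) /\
    forall l, is_eigenvalue k.+1 G l -> 1 - eps <= l <= 1 + eps].
Proof.
move=> p0 unitX /andP[e0 e1] hyp; pose j0 := Ordinal p0.
pose A : 'M_(n, p) := \matrix_(i, j) X i j; pose L := opnorm n p X ^+ 2.
have unitA j : \tr ((col j A)^T *m col j A) = 1.
  have -> : col j A = colv n (fun i => X i j) by apply/colP => i; rewrite !mxE.
  by rewrite -sqr_vnorm unitX // expr1n.
have boundA (v : 'cV_p) : \tr ((A *m v)^T *m (A *m v)) <= L * \tr (v^T *m v).
  rewrite -[v]colvK -colv_mxv -!sqr_vnorm /L -exprMn ler_sqr ?nnegrE ?vnorm_ge0 //.
    exact: opnorm_bound.
  exact: le_trans (vnorm_ge0 _ _) (opnorm_bound _ _ _ _).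
(* A basis vector is sent to a column of norm 1, hence [1 <= L]. *)
have L0 : 0 < L.
  apply: lt_le_trans ltr01 _; have := boundA (delta_mx j0 0).
  rewrite -colE unitA trmx_delta mul_delta_mx.
  by rewrite /mxtrace big_ord1 mxE !eqxx mulr1.
have trA_bound := tr_bound_transpose L0 boundA.
have pR0 : 0 < p%:R :> R by rewrite ltr0n.
have e2 : 0 < 1 + eps by rewrite addr_gt0.
set m := L * (1 + eps) / p%:R; have m0 : 0 < m by apply: divr_gt0 => //; apply: mulr_gt0.
have [d [d0 kd room]] : exists d, [/\ 0 < d, 2 * k%:R * d < eps &
    m <= (eps - (2 * k%:R - 2) * d) * d].
  (* For [k = 0] the barrier never moves and the condition reads [m <= (eps + 2 d) d], so a large
     [d] such as [m + 1] will do. *)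
  have [->|k0] := posnP k.
    by exists (m + 1); split; [lra|lra|nra].
  have kR0 : 0 < k%:R :> R by rewrite ltr0n.
  exists (eps / (4 * k%:R)); split; first by rewrite divr_gt0 ?mulr_gt0.
    have -> : 2 * k%:R * (eps / (4 * k%:R)) = eps / 2 by field; exact: lt0r_neq0.
    by lra.
  apply: (@barrier_room _ _ _ _ (ln k.+1%:R)) => //.
    have k1 : Rle 1 k.+1%:R by apply/RleP; rewrite ler1n.
    have /RleP := ln_ge_rational _ k1; rewrite RdivE -[IZR 2]/(2 : R).
    by rewrite RmultE RminusE RplusE -natr1 addrK -addrA.
  (* By the definition of [m], the bound in [hyp] is exactly [eps^2 / (4 m)]. *)
  rewrite natr1; apply: le_trans hyp _; rewrite le_eqVlt; apply/orP; left; apply/eqP.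
  by rewrite /m -/L; field; rewrite !lt0r_neq0.
have [T [sT [pU pW]]] := barrier_selection unitA trA_bound j0 L0 d0 e0 kd room.
exists T; split=> //; first exact: lower_gap_uniq (ltW e1) pW.
rewrite -sT; set G := gramT _ _ _.
have GE : \matrix_(a < size T, b < size T) G a b = (cols A j0 T)^T *m cols A j0 T.
  apply/matrixP => a b; rewrite !mxE /G /gramT rsumE; apply: eq_bigr => i _.
  by rewrite !mxE !nthE !(nth_map j0).
split.
  have [||l [v [v0 eig]]] := @symmetric_eigenvector _ _ ((cols A j0 T)^T *m cols A j0 T).
  - by rewrite sT.
  - by rewrite trmx_mul trmxK.
  by exists l; apply/is_eigenvalueP; exists v; rewrite ?GE.
move=> l /is_eigenvalueP[v v0]; rewrite GE; exact: eigenvalue_bounds.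
Qed.

Local Close Scope ring_scope.
Unset Implicit Arguments.
Import Corelib.Init.Peano.
Local Open Scope R_scope.

Theorem mainTheorem1 (n p : nat) (X : nat -> nat -> R) (eps : R) (Rn : nat) :
  (1 <= p)%nat ->
  (forall j, (j < p)%nat -> vnorm n (fun i => X i j) = 1) ->
  0 < eps < 1 ->
  (1 <= Rn)%nat ->
  INR Rn * ln (INR Rn) <= eps ^ 2 / (4 * (1 + eps)) * (INR p / (opnorm n p X) ^ 2) ->
  exists T : list nat,
    NoDup T /\ Forall (fun j => (j < p)%nat) T /\ (Rn <= length T)%nat /\
    1 - eps <= lambda_min (length T) (gramT n X T) /\
    lambda_min (length T) (gramT n X T) <= lambda_max (length T) (gramT n X T) /\
    lambda_max (length T) (gramT n X T) <= 1 + eps.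
Proof.
(* Writing [Rn = k + 1] matches the [k] barrier steps followed by one last column; the set found has
   exactly [Rn] elements. *)
case: Rn => [|k] /ssrnat.leP p1 unitX [/RltP e0 /RltP e1] R1 hyp.
  by case/ssrnat.leP: R1.
have [||||T [sT uT [ex bnd]]] := @selection_of_opnorm n p X eps k.
- exact: p1.
- by move=> j /ssrnat.ltP; exact: unitX.
- by rewrite e0 e1.
- move/RleP: hyp; have four : IZR 4 = GRing.natmul 1%R 4.
    by rewrite -INRE; simpl; Lra.lra.
  by rewrite !INRE !RpowE four !RdivE.
have lenT : length (map val T) = k.+1 by rewrite -[length _]/(size _) size_map.
exists (map val T); rewrite lenT; split.
  by apply: uniq_NoDup; rewrite map_inj_uniq //; exact: val_inj.
split.
  apply/Forall_forall => j; elim: T {sT uT ex bnd lenT} => //= i T IH [<-|/IH //].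
  exact/ssrnat.ltP/ltn_ord.
split; first by [].
exact: extreme_eigenvalues.
Qed.
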